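(* There exists a randomized $\frac{56}{627}$-competitive ($\frac{56}{627}\approx 0.0893$) online algorithm for the cardinality model, and it can be implemented in polynomial time at the cost of an $\varepsilon$ loss in the competitive ratio: for every constant $\varepsilon>0$ there is a polynomial time randomized $(\frac{56}{627}-\varepsilon)$-competitive online algorithm for this model. Moreover, if the objective function is restricted to be monotone, then there exists a polynomial time deterministic $\frac14$-competitive online algorithm for this model.
   Context: The cardinality model: there is an unknown finite ground set $\mathcal N=\{u_1,\dots,u_n\}$, a non-negative submodular function $f:2^{\mathcal N}\to\mathbb R_{\ge0}$ (not necessarily monotone), and a parameter $0\le k\le n$ known to the algorithm. A set $S\subseteq\mathcal N$ is feasible if and only if $|S|\le k$. The elements are revealed one by one in the order $u_1,\dots,u_n$, chosen by an adversary. The algorithm does not know $n$ in advance. It maintains feasible solutions $S_0=\varnothing,S_1,\dots,S_n$, where immediately after $u_i$ is revealed it chooses $S_i$ to be any feasible subset of $S_{i-1}\cup\{u_i\}$ (previously accepted elements may be dropped, but dropped or rejected elements cannot return). The choice may depend only on the values of $f$ on subsets of $\{u_1,\dots,u_i\}$ (accessed through a value oracle), the past, and, for randomized algorithms, internal randomness. The algorithm is $\alpha$-competitive if $\mathbb E[f(S_n)]\ge\alpha\cdot\max\{f(S): S\subseteq\mathcal N,\ |S|\le k\}$ for every instance. $f$ is monotone if $A\subseteq B\subseteq \mathcal N$ implies $f(A)\le f(B)$. Polynomial time means that the number of elementary operations and value oracle queries is polynomial in the number of elements revealed (for fixed $\varepsilon$), where arithmetic operations/comparisons on numbers and random draws count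 as elementary operations. *)

(* Defs.v *)
From HB Require Import structures.
From mathcomp Require Import all_boot all_order all_algebra.
From mathcomp Require Import reals.

Set Implicit Arguments.
Unset Strict Implicit.
Unset Printing Implicit Defensive.

Import Order.TTheory GRing.Theory Num.Theory.
Local Open Scope ring_scope.

(** * Set functions *)

Section SetFunctions.
Variables (R : realType) (n : nat).
Implicit Type f : {set 'I_n} -> R.

Definition nonnegative f := forall A : {set 'I_n}, 0 <= f A.

Definition submodular f :=
  forall A B : {set 'I_n}, f (A :|: B) + f (A :&: B) <= f A + f B.

Definition monotone f :=
  forall A B : {set 'I_n}, A \subset B -> f A <= f B.

(* [set0] is always feasible, so the default value [f set0] of the iterated
   maximum is one of the values over which the maximum is taken. *)
Definition opt (k : nat) f : R :=
  \big[Num.max/f set0]_(S : {set 'I_n} | (#|S| <= k)%N) f S.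

End SetFunctions.

(** * Finitely supported randomness *)

Section Randomness.
Variable R : realType.

(* [Flip p d1 d2] continues as [d1] with probability [p] and as [d2] with
   probability [1 - p], where [p] is first clipped to [0, 1]. *)
Inductive dist (A : Type) : Type :=
| Ret of A
| Flip of R & dist A & dist A.

Definition clip (p : R) : R := Num.min 1 (Num.max 0 p).

Fixpoint bind (A B : Type) (d : dist A) (g : A -> dist B) : dist B :=
  match d with
  | Ret x => g x
  | Flip p d1 d2 => Flip p (bind d1 g) (bind d2 g)
  end.

Fixpoint expect (A : Type) (d : dist A) (g : A -> R) : R :=
  match d with
  | Ret x => g x
  | Flip p d1 d2 => clip p * expect d1 g + (1 - clip p) * expect d2 g
  end.

Fixpoint supp (A : Type) (d : dist A) (x : A) : Prop :=
  match d with
  | Ret y => x = y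
  | Flip p d1 d2 => (0 < clip p /\ supp d1 x) \/ (clip p < 1 /\ supp d2 x)
  end.

End Randomness.

(** * Online algorithms for the cardinality model

    The ground set of an instance is ['I_n], and [u_1, ..., u_n] are the
    ordinals of values [0, ..., n - 1].  An algorithm does not know [n]; it
    refers to elements by their natural number value, and to sets of elements
    by predicates on [nat]. *)

Section Online.
Variable R : realType.

(* The information available once [i] elements are revealed: the values of [f]
   on the subsets of the first [i] elements. *)
Definition value_oracle (n : nat) (f : {set 'I_n} -> R) (i : nat) :
    pred nat -> R :=
  fun X => f [set j : 'I_n | (j < i)%N && X j].

(* The memory, which may record the whole past including previous random
   choices, is initialized from [k]. [step A i O m] is the random memory
   content after the [i]-th element is processed ([i >= 1]) starting from [m],
   when [O] is the value oracle at that time. [sol A m] is the solution held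
   in memory [m]. *)
Record online_alg := OnlineAlg {
  mem : Type;
  init : nat -> mem;
  step : nat -> (pred nat -> R) -> mem -> dist R mem;
  sol : mem -> pred nat
}.

Fixpoint run (A : online_alg) (k n : nat) (f : {set 'I_n} -> R) (i : nat) :
    dist R (mem A) :=
  if i is i'.+1 then
    bind (run A k f i') (@step A i (value_oracle f i))
  else Ret R (init A k).

Definition sol_set (A : online_alg) (n : nat) (m : mem A) : {set 'I_n} :=
  [set j : 'I_n | sol m j].

(* [S_0] is empty, every [S_i] has at most [k] elements, and [S_(i+1)] is a
   subset of [S_i] augmented with [u_(i+1)], whose value is [i]; this is
   required for all random outcomes of positive probability. *)
Definition online_feasible (A : online_alg) (k n : nat)
    (f : {set 'I_n} -> R) : Prop :=
  [/\ forall j, ~~ sol (init A k) j,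
      forall i m, (i <= n)%N -> supp (run A k f i) m ->
        (#|sol_set n m| <= k)%N
    & forall i m m', (i < n)%N -> supp (run A k f i) m ->
        supp (step i.+1 (value_oracle f i.+1) m) m' ->
        forall j, sol m' j -> sol m j || (j == i)].

Definition fun_class := forall n, ({set 'I_n} -> R) -> Prop.

Definition nonneg_submodular : fun_class :=
  fun n f => nonnegative f /\ submodular f.

Definition nonneg_submodular_monotone : fun_class :=
  fun n f => [/\ nonnegative f, submodular f & monotone f].

Definition competitive (cls : fun_class) (alpha : R) (A : online_alg) : Prop :=
  forall (n k : nat) (f : {set 'I_n} -> R), (k <= n)%N -> cls n f ->
    online_feasible A k f /\
    alpha * opt k f <= expect (run A k f n) (fun m => f (sol_set n m)).

End Online.

(** * Random access machines over the reals with a value oracle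

    The memory consists of infinitely many arrays of natural numbers and
    infinitely many arrays of reals; a scalar variable is entry 0 of an
    array. *)

Inductive nexpr : Type :=
| NCst of nat
| NGet of nat & nexpr              (* array, index *)
| NAdd of nexpr & nexpr
| NSub of nexpr & nexpr            (* truncated *)
| NMul of nexpr & nexpr.

Inductive rexpr : Type :=
| RCst of rat
| RGet of nat & nexpr              (* array, index *)
| RNat of nexpr
| RAdd of rexpr & rexpr
| ROpp of rexpr
| RMul of rexpr & rexpr
| RInv of rexpr.

Inductive bexpr : Type :=
| NLe of nexpr & nexpr
| RLe of rexpr & rexpr
| BNot of bexpr
| BAnd of bexpr & bexpr.

(* [Query a x b] stores into entry [x] of the real array [a] the value of the
   set of revealed elements [j] such that entry [j] of the natural number array
   [b] is nonzero. [Coin a x p] stores into entry [x] of the natural number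
   array [a] a random bit which is 1 with probability [p]. *)
Inductive cmd : Type :=
| Skip
| NSet of nat & nexpr & nexpr
| RSet of nat & nexpr & rexpr
| Seq of cmd & cmd
| If of bexpr & cmd & cmd
| While of bexpr & cmd
| Query of nat & nexpr & nat
| Coin of nat & nexpr & rexpr.

Fixpoint coin_free (c : cmd) : bool :=
  match c with
  | Coin _ _ _ => false
  | Seq c1 c2 | If _ c1 c2 => coin_free c1 && coin_free c2
  | While _ c1 => coin_free c1
  | _ => true
  end.

(* Natural number arrays through which a program communicates with its
   environment: the parameter [k], the number of elements revealed so far, and
   the characteristic vector of the current solution. *)
Definition arr_k : nat := 0.
Definition arr_i : nat := 1.
Definition arr_sol : nat := 2.

Section Machine.
Variable R : realType.

Record store := Store {
  nats : nat -> nat -> nat;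
  reals : nat -> nat -> R
}.

Definition upd (V : Type) (M : nat -> nat -> V) (a x : nat) (v : V) :
    nat -> nat -> V :=
  fun b y => if (b == a) && (y == x) then v else M b y.

Definition nset (s : store) (a x v : nat) : store :=
  Store (upd (nats s) a x v) (reals s).

Definition rset (s : store) (a x : nat) (v : R) : store :=
  Store (nats s) (upd (reals s) a x v).

Fixpoint neval (s : store) (e : nexpr) : nat :=
  match e with
  | NCst n => n
  | NGet a e1 => nats s a (neval s e1)
  | NAdd e1 e2 => (neval s e1 + neval s e2)%N
  | NSub e1 e2 => (neval s e1 - neval s e2)%N
  | NMul e1 e2 => (neval s e1 * neval s e2)%N
  end.

Fixpoint reval (s : store) (e : rexpr) : R :=
  match e with
  | RCst q => ratr q
  | RGet a e1 => reals s a (neval s e1)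
  | RNat e1 => (neval s e1)%:R
  | RAdd e1 e2 => reval s e1 + reval s e2
  | ROpp e1 => - reval s e1
  | RMul e1 e2 => reval s e1 * reval s e2
  | RInv e1 => (reval s e1)^-1
  end.

Fixpoint beval (s : store) (e : bexpr) : bool :=
  match e with
  | NLe e1 e2 => (neval s e1 <= neval s e2)%N
  | RLe e1 e2 => reval s e1 <= reval s e2
  | BNot e1 => ~~ beval s e1
  | BAnd e1 e2 => beval s e1 && beval s e2
  end.

(* The commands that remain to be executed, and the memory. *)
Definition config : Type := seq cmd * store.

(* One step evaluates the expressions of one command. For a fixed program
   these have bounded size, so a step is a bounded number of elementary
   operations, oracle queries and random draws. A halted configuration (no
   remaining command) is left unchanged. *)
Definition machine_step (O : pred nat -> R) (q : config) : dist R config :=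
  let: (w, s) := q in
  if w is c :: w' then
    match c with
    | Skip => Ret R (w', s)
    | NSet a x e => Ret R (w', nset s a (neval s x) (neval s e))
    | RSet a x e => Ret R (w', rset s a (neval s x) (reval s e))
    | Seq c1 c2 => Ret R (c1 :: c2 :: w', s)
    | If b c1 c2 => Ret R ((if beval s b then c1 else c2) :: w', s)
    | While b c1 => Ret R (if beval s b then c1 :: w else w', s)
    | Query a x b =>
        Ret R (w', rset s a (neval s x) (O (fun j => nats s b j != 0%N)))
    | Coin a x p =>
        Flip (reval s p) (Ret R (w', nset s a (neval s x) 1%N))
                         (Ret R (w', nset s a (neval s x) 0%N))
    end
  else Ret R q.

Fixpoint machine_steps (O : pred nat -> R) (t : nat) (q : config) :
    dist R config :=
  if t is t'.+1 then bind (machine_step O q) (machine_steps O t')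
  else Ret R q.

Definition init_store (k : nat) : store :=
  nset (Store (fun _ _ => 0%N) (fun _ _ => 0)) arr_k 0 k.

(* The program [P] is executed once for every revealed element, for [T i] steps
   at the arrival of the [i]-th one; the memory persists between arrivals. *)
Definition machine_alg (P : cmd) (T : nat -> nat) : online_alg R :=
  {| mem := config;
     init := fun k => ([::], init_store k);
     step := fun i O q => machine_steps O (T i) ([:: P], nset q.2 arr_i 0 i);
     sol := fun q j => nats q.2 arr_sol j != 0%N |}.

(* All executions of [P] terminate within their [T i] steps. *)
Definition halts_within (cls : fun_class R) (P : cmd) (T : nat -> nat) : Prop :=
  forall (n k : nat) (f : {set 'I_n} -> R), (k <= n)%N -> cls n f ->
  forall (i : nat) (q : config), (i <= n)%N ->
    supp (run (machine_alg P T) k f i) q -> q.1 = [::].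

(* Bounding the time spent at the arrival of the [i]-th element by a polynomial
   in [i] is the same as bounding the total time up to that point by one. *)
Definition poly_time_competitive (cls : fun_class R) (alpha : R) (P : cmd) :
    Prop :=
  exists C d : nat, let T := fun i => (C * i ^ d)%N in
    halts_within cls P T /\ competitive cls alpha (machine_alg P T).

End Machine.

(* Main.v *)
Require Import Defs.
From mathcomp Require Import all_boot all_order all_algebra.
From mathcomp Require Import reals.
From mathcomp Require Import ring lra zify.

Set Implicit Arguments.
Unset Strict Implicit.
Unset Printing Implicit Defensive.

Import Order.TTheory GRing.Theory Num.Theory.
Local Open Scope ring_scope.

(* Every new element [u] is sampled with probability [q].  A sampled [u] is added
   to the solution [S] as long as there is room and this does not decrease [f];
   when [S] is full, [u] is swapped for some [j] in [S] if this increases [f]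
   by at least [max 0 (lam * w)], where [w = f (u |: S) - f S].

   If [u] fails this test then [(1 - lam) * w <= f S / k], by averaging over [j].
   Let [B] be the set of all elements ever accepted and [O] an optimal set.
   Charging accepted elements to the increments of [f S], and rejected elements
   of [O] to [f S / k], gives
     [E f (B :|: O) <= (1 / (lam * q) + 1 / (1 - lam)) * E f (S_n)].
   As each element enters [B] with conditional probability 0 or [q],
   [E f (B :|: O) >= (1 - q) * f O]; if [f] is monotone, take [q = 1] and
   use [f (B :|: O) >= f O] instead. *)

(** * Submodular functions *)

Section Submodular.
Variables (R : realType) (n : nat) (f : {set 'I_n} -> R).
Hypothesis f_sub : submodular f.

(** Diminishing returns, from submodularity at [u |: A] and [B]. The condition on [u] is what makes
    their intersection exactly [A], and it still allows [u] to lie in both sets. *)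
Lemma submodular_marginal (A B : {set 'I_n}) (u : 'I_n) :
  A \subset B -> (u \in B -> u \in A) ->
  f (u |: B) - f B <= f (u |: A) - f A.
Proof.
move=> sAB uBA; have := f_sub (u |: A) B.
have -> : (u |: A) :|: B = u |: B by rewrite -setUA (setUidPr sAB).
have -> : (u |: A) :&: B = A.
  apply/setP=> x; rewrite !inE; case: eqVneq => [->|_] /=.
    by apply/idP/idP=> [/uBA //|]; apply: (subsetP sAB).
  by apply/andP/idP=> [[]//|xA]; split=> //; apply: (subsetP sAB).
by move=> ?; lra.
Qed.


(** Peel off the elements of [S] one at a time: the marginal of [j] on [T :\ j] is at most its
    marginal on the current [S :\ j], and the latter marginals telescope. *)
Lemma sum_marginals_le (T S : {set 'I_n}) : S \subset T ->
  \sum_(j in S) (f T - f (T :\ j)) <= f S - f set0.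
Proof.
move: {2}#|S| (leqnn #|S|) => m; elim: m S => [|m IH] S leS sST.
  move: leS; rewrite leqn0 cards_eq0 => /eqP ->.
  by rewrite big_set0 subrr.
have [->|[j jS]] := set_0Vmem S; first by rewrite big_set0 subrr.
rewrite (big_setD1 j jS) /=.
have sSjT : S :\ j \subset T by apply: subset_trans sST; apply: subsetDl.
have cSj : (#|S :\ j| <= m)%N by move: leS; rewrite (cardsD1 j S) jS.
have := IH _ cSj sSjT.
have jT : j \in T by apply: (subsetP sST).
have := @submodular_marginal (S :\ j) (T :\ j) j (setSD _ sST).
rewrite !setD1K // !inE eqxx => /(_ (fun x => x)).
by move=> ? ?; lra.
Qed.

End Submodular.

(** * Finitely supported distributions *)

Section Expectation.
Variable R : realType.

Lemma clip_id (p : R) : 0 <= p <= 1 -> clip p = p.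
Proof. by move=> /andP[p0 p1]; rewrite /clip max_r // min_r. Qed.

Lemma bindA (A B C : Type) (d : dist R A) (g : A -> dist R B)
    (h : B -> dist R C) :
  bind (bind d g) h = bind d (fun x => bind (g x) h).
Proof. by elim: d => //= p d1 -> d2 ->. Qed.

Lemma expect_bind (A B : Type) (d : dist R A) (g : A -> dist R B)
    (h : B -> R) :
  expect (bind d g) h = expect d (fun x => expect (g x) h).
Proof. by elim: d => //= p d1 -> d2 ->. Qed.

Lemma supp_bind (A B : Type) (d : dist R A) (g : A -> dist R B) y :
  supp (bind d g) y -> exists2 x, supp d x & supp (g x) y.
Proof.
elim: d => [x|p d1 IH1 d2 IH2] /=; first by exists x.
by case=> -[hp] => [/IH1|/IH2] [x hx hy]; exists x => //; [left|right].
Qed.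

End Expectation.

(** * The competitive ratio of sampled exchanges *)

Section Exchange.
Variables (R : realType) (n k : nat) (f : {set 'I_n} -> R) (lam : R).

(** The disjuncts are rejection and acceptance of [u]. The rejection bound is multiplied out so that
    it makes sense for [k = 0]. *)
Definition exchange (u : 'I_n) (S S' : {set 'I_n}) : Prop :=
  (S' = S /\ k%:R * ((1 - lam) * (f (u |: S) - f S)) <= f S) \/
  [/\ S' \subset u |: S, f S <= f S'
    & lam * (f (u |: S) - f S) <= f S' - f S].

(* The marginals [f (S + u) - f (S + u - j)] sum to at most [f S] over [j],
   so some swap has gain at least [f (S + u) - f S - f S / k]. *)
Lemma no_swap_exchange (u : 'I_n) (S : {set 'I_n}) :
  nonnegative f -> submodular f -> 0 <= lam < 1 -> u \notin S -> #|S| = k ->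
  {in S, forall j, ~~ ((f S <= f ((u |: S) :\ j)) &&
    (f S + lam * (f (u |: S) - f S) <= f ((u |: S) :\ j)))} ->
  exchange u S S.
Proof.
move=> f0 f_sub /andP[lam0 lam1] uS cS noswap; left; split=> //.
set w := f (u |: S) - f S.
have [w0|w0] := leP w 0.
  apply: (@le_trans _ _ 0); last exact: f0.
  by rewrite mulr_ge0_le0 // mulr_ge0_le0 // subr_ge0 ltW.
have lw0 : 0 <= lam * w by rewrite mulr_ge0 // ltW.
have : \sum_(j in S) (1 - lam) * w <=
       \sum_(j in S) (f (u |: S) - f ((u |: S) :\ j)).
  apply: ler_sum => j jS; have := noswap j jS.
  rewrite -/w; case: leP => [_|] /=; last by rewrite /w in lw0 *; lra.
  by rewrite -ltNge /w; lra.
rewrite sumr_const cS mulr_natl => /le_trans; apply.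
apply: le_trans (sum_marginals_le f_sub _) _; first exact: subsetUr.
by have := f0 set0; lra.
Qed.

End Exchange.

(** * Competitive analysis of algorithms whose steps are sampled exchanges *)

Section Analysis.
Variables (R : realType) (A : online_alg R).
Variables (n k : nat) (f : {set 'I_n} -> R) (lam q : R).
Variable inv : nat -> Defs.mem A -> Prop.

(* [m1] and [m0] are the memories reached when [u] is, respectively is not,
   sampled. *)
Definition sampled_exchange (u : 'I_n) (m m1 m0 : Defs.mem A) : Prop :=
  let d := step (o := A) u.+1 (value_oracle f u.+1) m in
  [/\ exchange k f lam u (sol_set n m) (sol_set n m1),
      sol_set n m0 = sol_set n m,
      forall g, expect d g = q * g m1 + (1 - q) * g m0
    & forall m', supp d m' -> m' = m1 \/ m' = m0].

Hypothesis inv_init : inv 0 (init A k).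
Hypothesis inv_step : forall (u : 'I_n) m, inv u m ->
  exists m1 m0, [/\ inv u.+1 m1, inv u.+1 m0 & sampled_exchange u m m1 m0].
Hypothesis inv_sol : forall i m, inv i m ->
  (#|sol_set n m| <= k)%N /\ forall x, sol m x -> (x < i)%N.

Lemma supp_run_inv i m : (i <= n)%N -> supp (run A k f i) m -> inv i m.
Proof.
elim: i m => [|i IH] m ltin /=; first by move->.
move=> h; have [m' /(IH _ (ltnW ltin)) hm'] := supp_bind h.
have [m1 [m0 [h1 h0 [_ _ _ hs]]]] := @inv_step (Ordinal ltin) _ hm'.
by case/hs => ->.
Qed.

Lemma sampled_exchange_feasible : (k <= n)%N -> online_feasible A k f.
Proof.
move=> lekn; split.
- by move=> j; apply/negP=> /(proj2 (@inv_sol _ _ inv_init)).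
- by move=> i m lein /(supp_run_inv lein) /inv_sol [].
- move=> i m m' ltin /(supp_run_inv (ltnW ltin)) hm.
  have [m1 [m0 [h1 h0 [ex e0 _ hs]]]] := @inv_step (Ordinal ltin) _ hm.
  move=> /= hm' x hx.
  have hx' : (x < i.+1)%N.
    by case/hs: hm' hx => -> /(proj2 (@inv_sol _ _ _)); apply.
  have ltxn := leq_trans hx' ltin.
  have: Ordinal ltxn \in sol_set n m' by rewrite inE.
  have memS : Ordinal ltxn \in sol_set n m -> sol m x || (x == i).
    by rewrite inE => ->.
  case/hs: hm' => ->; last by rewrite e0.
  case: ex => [[-> _] //|[/subsetP sub _ _]] /sub.
  by rewrite in_setU1 => /orP[/eqP[->]|//]; rewrite eqxx orbT.
Qed.

Hypothesis f0 : nonnegative f.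
Hypothesis f_sub : submodular f.
Hypothesis lam01 : 0 < lam < 1.
Hypothesis q01 : 0 < q <= 1.
Variables (O : {set 'I_n}) (L : R).
Hypothesis leOk : (#|O| <= k)%N.
(** This treats both cases of the theorem at once: [L] is 0 for a general [f] and [f O] for a
    monotone one. *)
Hypothesis leL : forall X : {set 'I_n}, O \subset X -> L <= f X.

(** Expected final value given memory [m] after [i] elements, with [t] still to come. Whereas [run]
    unfolds from the last element, this unfolds from the next one, so an induction can carry history
    that [m] does not record. *)
Fixpoint value_to_go (t i : nat) (m : Defs.mem A) : R :=
  if t is t'.+1 then
    expect (step (o := A) i.+1 (value_oracle f i.+1) m) (value_to_go t' i.+1)
  else f (sol_set n m).

Lemma expect_run t i :
  expect (run A k f (i + t)) (fun m => f (sol_set n m)) =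
  expect (run A k f i) (value_to_go t i).
Proof.
by elim: t i => [|t IH] i; rewrite ?addn0 // addnS -addSn IH /= expect_bind.
Qed.

Let before (i : nat) : {set 'I_n} := [set j in O | (j < i)%N].

(* [B] stands for the set of all elements accepted so far, and [D] for the set
   of those which were or would have been accepted had they been sampled.  When
   [u] is accepted if sampled, [f (B :|: O) - q * f (D :|: O)] grows in
   expectation by [q] times the difference of the marginals of [u] on [B :|: O]
   and on [D :|: O], which is nonnegative as [B \subset D]. *)
Let potential (i : nat) (S B D : {set 'I_n}) : R :=
  ((lam * q)^-1 + (1 - lam)^-1 * (#|before i|%:R / k%:R)) * f S
  - f (B :|: before i) + f (B :|: O) - q * f (D :|: O).

Let beforeS (u : 'I_n) :
  before u.+1 = if u \in O then u |: before u else before u.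
Proof.
apply/setP=> j; rewrite fun_if !inE ltnS leq_eqVlt.
by case: ifP => uO; rewrite !inE; case: (eqVneq (j : nat) u) => /= [/val_inj->|ne];
  rewrite ?eqxx ?uO ?ltnn ?andbF // -?val_eqE ?(negPf ne).
Qed.

(** Only [u] in [O] changes anything: the count of [before] grows by one, and the resulting
    [f S / (k (1 - lam))] pays for the marginal of [u] on [B :|: before u], which is at most its
    marginal on [S]. *)
Lemma potential_reject (u : 'I_n) (S B D : {set 'I_n}) :
  S \subset B -> {in B, forall j : 'I_n, (j < u)%N} ->
  k%:R * ((1 - lam) * (f (u |: S) - f S)) <= f S ->
  potential u S B D <= potential u.+1 S B D.
Proof.
move=> sSB ltB rej; rewrite /potential beforeS; case: ifP => // uO.
have ub : u \notin before u by rewrite inE ltnn andbF.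
have uB : u \notin B by apply/negP=> /ltB; rewrite ltnn.
have k0 : 0 < k%:R :> R.
  by rewrite ltr0n; apply: leq_trans leOk; apply/card_gt0P; exists u.
have l0 : 0 < 1 - lam by case/andP: lam01 => *; lra.
rewrite cardsU1 ub natrD (setUCA B).
have : f (u |: (B :|: before u)) - f (B :|: before u) <=
       (1 - lam)^-1 * (1 / k%:R) * f S.
  apply: le_trans (_ : f (u |: S) - f S <= _).
    apply: submodular_marginal => //; first by apply: subset_trans sSB _; apply: subsetUl.
    by rewrite inE (negPf uB) (negPf ub).
  by rewrite mul1r -mulrA ler_pdivlMl // ler_pdivlMl.
by rewrite [true%:R]mulr1n; move: (k%:R^-1) ((1-lam)^-1) ((lam*q)^-1) => x y z ?; lra.
Qed.

(** The expected gain in [f S], weighted by [(lam * q)^-1], pays for the marginal of [u] on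
    [B :|: before u]; the terms in [O] are compared through [B \subset D]. *)
Lemma potential_accept (u : 'I_n) (S S' B D : {set 'I_n}) :
  S \subset B -> B \subset D -> {in D, forall j : 'I_n, (j < u)%N} ->
  f S <= f S' -> lam * (f (u |: S) - f S) <= f S' - f S ->
  potential u S B D <=
  q * potential u.+1 S' (u |: B) (u |: D) +
  (1 - q) * potential u.+1 S B (u |: D).
Proof.
move=> sSB sBD ltD gain0 gain.
have [/andP[l0 l1] /andP[q0 q1]] := (lam01, q01).
have ub : u \notin before u by rewrite inE ltnn andbF.
have uD : u \notin D by apply/negP=> /ltD; rewrite ltnn.
have uB : u \notin B by apply: contraNN uD; apply: (subsetP sBD).
have marg : f (u |: (B :|: before u)) - f (B :|: before u) <= f (u |: S) - f S.
  apply: submodular_marginal => //; first by apply: subset_trans sSB _; apply: subsetUl.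
  by rewrite inE (negPf uB) (negPf ub).
have margO : f (u |: (D :|: O)) - f (D :|: O) <= f (u |: (B :|: O)) - f (B :|: O).
  apply: submodular_marginal => //; first exact: setSU.
  by rewrite !inE (negPf uD) /= => ->; rewrite orbT.
have {}gain : (f (u |: S) - f S) <= lam^-1 * (f S' - f S).
  by rewrite ler_pdivlMl.
have gain0' : 0 <= lam^-1 * (f S' - f S) by rewrite mulr_ge0 ?subr_ge0 ?invr_ge0 // ltW.
rewrite /potential -!setUA.
set x := (lam * q)^-1 + (1 - lam)^-1 * (#|before u|%:R / k%:R).
set x' := (lam * q)^-1 + (1 - lam)^-1 * (#|before u.+1|%:R / k%:R).
have xx' : x <= x'.
  rewrite lerD2l ler_wpM2l ?invr_ge0 ?subr_ge0 ?(ltW l1) //.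
  rewrite ler_wpM2r ?invr_ge0 // ler_nat subset_leq_card //.
  by apply/subsetP=> j; rewrite !inE => /andP[-> /= /ltnW].
have xa : (lam * q)^-1 <= x.
  by rewrite lerDl mulr_ge0 ?invr_ge0 ?subr_ge0 ?(ltW l1) // divr_ge0.
(* The gain occurs only with probability [q]; the factor [q^-1] in the coefficient compensates for
   this. *)
have qx' : lam^-1 * (f S' - f S) <= q * x' * (f S' - f S).
  rewrite ler_wpM2r ?subr_ge0 // -ler_pdivrMl // mulrC -invfM.
  exact: le_trans xa xx'.
have xS : x * f S <= x' * f S by rewrite ler_wpM2r.
have qm : q * (f (u |: (D :|: O)) - f (D :|: O)) <=
          q * (f (u |: (B :|: O)) - f (B :|: O)) by rewrite ler_wpM2l // ltW.
(* If [u] is in [O], it enters [B :|: before] in both branches and its marginal is paid in full;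
   otherwise it enters only when sampled, and a [q] fraction is paid. *)
rewrite beforeS; case: ifP => uO.
  have -> : B :|: (u |: before u) = u |: (B :|: before u) by rewrite setUCA.
  have -> : u |: (u |: (B :|: before u)) = u |: (B :|: before u).
    by rewrite setUA setUid.
  by lra.
have qm2 : q * (f (u |: (B :|: before u)) - f (B :|: before u)) <=
    lam^-1 * (f S' - f S).
  apply: (@le_trans _ _ (q * (lam^-1 * (f S' - f S)))).
    by rewrite ler_wpM2l ?(ltW q0) //; apply: le_trans gain.
  by rewrite ler_piMl.
by lra.
Qed.

(** The potential does not decrease in expectation when [B] and [D] are updated suitably. They
    depend on the history and not on [m] alone, so the induction on [t] quantifies over them. *)
Lemma potential_le_value_to_go t i m (B D : {set 'I_n}) :
  (i + t)%N = n -> inv i m ->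
  sol_set n m \subset B -> B \subset D -> {in D, forall j : 'I_n, (j < i)%N} ->
  potential i (sol_set n m) B D + q * L <=
  ((lam * q)^-1 + (1 - lam)^-1) * value_to_go t i m.
Proof.
have [/andP[l0 l1] /andP[q0 q1]] := (lam01, q01).
have l0' : 0 < 1 - lam by rewrite subr_gt0.
set c := (lam * q)^-1 + (1 - lam)^-1.
elim: t i m B D => [|t IH] i m B D /= e hm sSB sBD ltD.
  rewrite addn0 in e; rewrite /potential.
  (* After the last element the terms [f (B :|: before i)] and [f (B :|: O)] cancel. *)
  have -> : before i = O by apply/setP=> j; rewrite !inE e ltn_ord andbT.
  have : q * L <= q * f (D :|: O).
    by rewrite ler_wpM2l ?(ltW q0) // leL // subsetUr.
  have : (1 - lam)^-1 * (#|O|%:R / k%:R) * f (sol_set n m) <=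
         (1 - lam)^-1 * f (sol_set n m).
    rewrite -mulrA ler_wpM2l ?invr_ge0 ?(ltW l0') // ler_piMl //.
    (* For [k = 0] the quotient is 0, as the inverse of 0 is 0. *)
    case: (k) leOk => [|k' h]; first by rewrite invr0 mulr0.
    by rewrite ler_pdivrMr ?ltr0n // mul1r ler_nat.
  by rewrite /c !mulrDl => *; lra.
have ltin : (i < n)%N by rewrite -e addnS ltnS leq_addr.
pose u := Ordinal ltin.
have [m1 [m0 [h1 h0 [ex e0 hE _]]]] := @inv_step u _ hm.
rewrite hE.
have e' : (i.+1 + t)%N = n by rewrite addSnnS.
have ltB : {in B, forall j : 'I_n, (j < u)%N}.
  by move=> j jB; apply: ltD; apply: (subsetP sBD).
have bound X Y : X <= c * value_to_go t i.+1 m1 ->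
    Y <= c * value_to_go t i.+1 m0 ->
    q * X + (1 - q) * Y <=
    c * (q * value_to_go t i.+1 m1 + (1 - q) * value_to_go t i.+1 m0).
  move=> hX hY; rewrite mulrDr !(mulrCA c) lerD // ler_wpM2l ?subr_ge0 //.
  exact: ltW.
(* After a rejection [B] and [D] are kept in both branches; after an acceptance [u] joins [D] in
   both, but [B] only in the sampled one. *)
case: ex => [[e1 rej]|[sub gain0 gain]].
  have ltD' : {in D, forall j : 'I_n, (j < i.+1)%N}.
    by move=> j /ltD /ltnW.
  have := IH _ m1 B D e' h1; rewrite e1 => /(_ sSB sBD ltD') b1.
  have := IH _ m0 B D e' h0; rewrite e0 => /(_ sSB sBD ltD') b0.
  have := bound _ _ b1 b0; rewrite -mulrDl addrC subrK mul1r.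
  by apply: le_trans; rewrite lerD2r; apply: (potential_reject (u := u)).
have ltD' : {in u |: D, forall j : 'I_n, (j < i.+1)%N}.
  by move=> j; rewrite !inE => /orP[/eqP-> //|/ltD /ltnW].
have sS1 : sol_set n m1 \subset u |: B by apply: subset_trans sub _; apply: setUS.
have sBD' : B \subset u |: D by apply: subset_trans sBD _; apply: subsetUr.
have b1 := IH _ m1 _ _ e' h1 sS1 (setUS [set u] sBD) ltD'.
have := IH _ m0 B _ e' h0; rewrite e0 => /(_ _ sSB sBD' ltD') b0.
apply: le_trans (bound _ _ b1 b0).
have := potential_accept (u := u) sSB sBD ltD gain0 gain.
rewrite /u /=.
by move: (potential _ _ _ _) (potential _ _ _ _) (potential _ _ _ _) => x y z; lra.
Qed.

(** Start the potential with [B = D = set0]: it is at least [(1 - q) * f O], because [lam * q <= 1]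
    lets the coefficient of [f set0] absorb the subtracted [f set0]. *)
Lemma sampled_exchange_value :
  (1 - q) * f O + q * L <=
  ((lam * q)^-1 + (1 - lam)^-1) *
  expect (run A k f n) (fun m => f (sol_set n m)).
Proof.
have [/andP[l0 l1] /andP[q0 q1]] := (lam01, q01).
rewrite -[X in run _ _ _ X]add0n expect_run /=.
have S0 : sol_set n (init A k) = set0.
  apply/setP=> j; rewrite !inE; apply/negP => h.
  by have := (@inv_sol _ _ inv_init).2 j h.
have := @potential_le_value_to_go n 0 _ set0 set0 (add0n n) inv_init.
rewrite S0 => /(_ (sub0set _) (sub0set _)) /(_ _).
have ltD : {in set0, forall j : 'I_n, (j < 0)%N} by move=> j; rewrite inE.
move=> /(_ ltD); apply: le_trans; rewrite lerD2r /potential.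
have -> : before 0 = set0 by apply/setP=> j; rewrite !inE andbF.
rewrite cards0 mul0r mulr0 addr0 !set0U.
have : f set0 <= (lam * q)^-1 * f set0.
  rewrite ler_peMl // invf_ge1 ?mulr_gt0 //.
  by rewrite mulr_ile1 // ltW.
by move=> ?; lra.
Qed.

End Analysis.

(** * The program *)

Definition arr_size : nat := 3.
Definition arr_coin : nat := 4.
Definition arr_next : nat := 5.
Definition arr_done : nat := 6.
Definition arr_val : nat := 0.

Definition scalar (a : nat) : nexpr := NGet a (NCst 0).
(** In the notation of the analysis, the three values are those of [f] at [S], [u |: S] and
    [(u |: S) :\ j]. *)
Definition val_old : rexpr := RGet arr_val (NCst 0).
Definition val_add : rexpr := RGet arr_val (NCst 1).
Definition val_swap : rexpr := RGet arr_val (NCst 2).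
Definition newest : nexpr := NSub (scalar arr_i) (NCst 1).

Definition swap_test (l : rat) : bexpr :=
  BAnd (RLe val_old val_swap)
       (RLe (RAdd val_old (RMul (RCst l) (RAdd val_add (ROpp val_old))))
            val_swap).

(** The candidate is removed in place, so that the query sees the swapped set, and put back if the
    test fails. *)
Definition try_swap (l : rat) : cmd :=
  Seq (NSet arr_sol (scalar arr_next) (NCst 0))
 (Seq (Query arr_val (NCst 2) arr_sol)
      (If (swap_test l) (NSet arr_done (NCst 0) (NCst 1))
                        (NSet arr_sol (scalar arr_next) (NCst 1)))).

Definition swap_loop (l : rat) : cmd :=
  While (BAnd (NLe (NAdd (scalar arr_next) (NCst 1)) newest)
              (NLe (scalar arr_done) (NCst 0)))
    (Seq (If (NLe (NCst 1) (NGet arr_sol (scalar arr_next)))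
             (try_swap l) Skip)
         (NSet arr_next (NCst 0) (NAdd (scalar arr_next) (NCst 1)))).

(** Here and in [swap] the newest element is already in [arr_sol], put there for the query of
    [val_add]; rejecting it means erasing it again. *)
Definition grow : cmd :=
  If (RLe val_old val_add)
     (NSet arr_size (NCst 0) (NAdd (scalar arr_size) (NCst 1)))
     (NSet arr_sol newest (NCst 0)).

Definition swap (l : rat) : cmd :=
  Seq (NSet arr_next (NCst 0) (NCst 0))
 (Seq (NSet arr_done (NCst 0) (NCst 0))
 (Seq (swap_loop l)
      (If (NLe (scalar arr_done) (NCst 0)) (NSet arr_sol newest (NCst 0))
          Skip))).

Definition process_newest (l : rat) : cmd :=
  Seq (Query arr_val (NCst 0) arr_sol)
 (Seq (NSet arr_sol newest (NCst 1))
 (Seq (Query arr_val (NCst 1) arr_sol)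
      (If (NLe (NAdd (scalar arr_size) (NCst 1)) (scalar arr_k))
          grow (swap l)))).

(* [draw] puts the sampling bit into [arr_coin]. *)
Definition sampled_swaps (draw : cmd) (l : rat) : cmd :=
  Seq draw (If (NLe (NCst 1) (scalar arr_coin)) (process_newest l) Skip).

(** * Coin-free executions with a bound on the number of steps *)

Section Reachability.
Variables (R : realType) (O : pred nat -> R).

Lemma machine_stepsD t t' q :
  machine_steps O (t + t') q =
  bind (machine_steps O t q) (machine_steps O t').
Proof.
elim: t q => //= t IH q; rewrite bindA.
by elim: (machine_step O q) => [x|p d1 IH1 d2 IH2] /=; rewrite ?IH ?IH1 ?IH2.
Qed.

(** An upper bound on the steps lets branches of different lengths share one bound; a halted
    configuration then idles through the remaining time. *)
Definition reaches (t : nat) (q q' : config R) : Prop :=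
  exists2 t0, (t0 <= t)%N & machine_steps O t0 q = Ret R q'.

Lemma reaches_refl t q : reaches t q q.
Proof. by exists 0%N. Qed.

Lemma reaches_step t q q1 q' :
  machine_step O q = Ret R q1 -> reaches t q1 q' -> reaches t.+1 q q'.
Proof. by move=> e [t0 le h]; exists t0.+1; rewrite //= e. Qed.

Lemma reaches_trans t t' q q1 q' :
  reaches t q q1 -> reaches t' q1 q' -> reaches (t + t') q q'.
Proof.
move=> [t0 le h] [t0' le' h']; exists (t0 + t0')%N; first exact: leq_add.
by rewrite machine_stepsD h.
Qed.

Lemma reaches_leq t t' q q' : (t <= t')%N -> reaches t q q' -> reaches t' q q'.
Proof. by move=> le [t0 le0 h]; exists t0 => //; apply: leq_trans le. Qed.

Lemma reaches_halted t q s :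
  reaches t q ([::], s) -> machine_steps O t q = Ret R ([::], s).
Proof.
move=> [t0 le h]; rewrite -(subnKC le) machine_stepsD h /=.
by elim: (_ - _)%N.
Qed.

End Reachability.

(** * Correctness and running time of the swap loop *)

Section Correctness.
Variables (R : realType) (n : nat) (f : {set 'I_n} -> R) (l : rat).

(** All natural indices are covered, including those from [n] on, because feasibility constrains the
    solution there as well. *)
Definition tracks (s : store R) (S : {set 'I_n}) : Prop :=
  forall x : nat, (nats s arr_sol x != 0%N) = (x \in [seq val j | j in S]).

Lemma tracks_ord s S (j : 'I_n) :
  tracks s S -> (nats s arr_sol j != 0%N) = (j \in S).
Proof. by move->; rewrite mem_map ?mem_enum //; apply: val_inj. Qed.

Lemma tracks_sol_set s S (q : seq cmd) (P : cmd) (T : nat -> nat) :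
  tracks s S -> @sol_set R (machine_alg R P T) n (q, s) = S.
Proof. by move=> h; apply/setP=> j; rewrite inE /= (tracks_ord _ h). Qed.

Lemma tracks_add s S (u : 'I_n) v :
  tracks s S -> tracks (nset s arr_sol u v.+1) (u |: S).
Proof.
move=> h x; rewrite /= /upd /=; apply/idP/mapP.
  case: (eqVneq x u) => [->|ne]; first by exists u; rewrite // mem_enum setU11.
  rewrite h => /mapP[j]; rewrite mem_enum => jS ->.
  by exists j; rewrite // mem_enum setU1r.
move=> [j]; rewrite mem_enum => ju ->; case: ifP => // ne.
rewrite (tracks_ord _ h); move: ju; rewrite in_setU1.
by rewrite -val_eqE ne.
Qed.

Lemma tracks_del s S (u : 'I_n) :
  tracks s S -> tracks (nset s arr_sol u 0) (S :\ u).
Proof.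
move=> h x; rewrite /= /upd /=; apply/idP/mapP.
  case: (eqVneq x u) => // ne.
  rewrite h => /mapP[j]; rewrite mem_enum => jS e; exists j => //.
  by rewrite mem_enum in_setD1 jS -val_eqE -e ne.
move=> [j]; rewrite mem_enum in_setD1 => /andP[ne jS] ->.
by rewrite val_eqE (negPf ne) (tracks_ord _ h).
Qed.

Lemma oracle_tracks s S (i : nat) :
  tracks s S -> {in S, forall j : 'I_n, (j < i)%N} ->
  value_oracle f i (fun j => nats s arr_sol j != 0%N) = f S.
Proof.
move=> h lt; congr f; apply/setP=> j; rewrite inE (tracks_ord _ h).
by apply/andP/idP=> [[]|jS] //; rewrite jS lt.
Qed.

Definition same_env (s s' : store R) : Prop :=
  [/\ nats s' arr_k = nats s arr_k, nats s' arr_i = nats s arr_i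
    & nats s' arr_size = nats s arr_size].

Lemma same_env_trans s1 s2 s3 :
  same_env s1 s2 -> same_env s2 s3 -> same_env s1 s3.
Proof. by rewrite /same_env => -[<- <- <-] [-> -> ->]. Qed.

Variables (S : {set 'I_n}) (u : 'I_n).
Hypothesis ltS : {in S, forall j : 'I_n, (j < u)%N}.
Let O := value_oracle f u.+1.
Let lam : R := ratr l.

Definition good_swap (j : 'I_n) : bool :=
  (f S <= f ((u |: S) :\ j)) &&
  (f S + lam * (f (u |: S) - f S) <= f ((u |: S) :\ j)).

Definition swap_ready (s : store R) (next : nat) : Prop :=
  [/\ tracks s (u |: S), nats s arr_i 0 = u.+1, nats s arr_next 0 = next
    & [/\ nats s arr_done 0 = 0%N, reals s arr_val 0 = f S
        & reals s arr_val 1 = f (u |: S)]].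

Definition swap_result (s : store R) (next : nat) : Prop :=
  ((nats s arr_done 0 = 0%N) /\ tracks s (u |: S) /\
   {in S, forall j : 'I_n, (next <= j)%N -> ~~ good_swap j}) \/
  (nats s arr_done 0 = 1%N /\
   exists2 j, j \in S & good_swap j /\ tracks s ((u |: S) :\ j)).

(** Induction on the number [d] of positions left to scan, at 10 steps per iteration at most, plus
    one for the final failing guard. *)
Lemma swap_loop_spec d s next w :
  (next + d)%N = u -> swap_ready s next ->
  exists s', [/\ reaches O (10 * d + 1) (swap_loop l :: w, s) (w, s'),
                 same_env s s' & swap_result s' next].
Proof.
have ltuS : {in u |: S, forall j : 'I_n, (j < u.+1)%N}.
  by move=> j; rewrite in_setU1 => /orP[/eqP->|/ltS /ltnW].
elim: d s next => [|d IH] s next e [tr hi hn [hd h0 h1]].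
  exists s; split=> //; last first.
    by left; split=> //; split=> // j /ltS; rewrite -e addn0 ltnNge => /negPf->.
  apply: reaches_step (reaches_refl _ _ _) => /=.
  by rewrite hi hn -e !subn1 addn0 addn1 ltnn.
have ltnu : (next < u)%N by rewrite -e addnS ltnS leq_addr.
pose j := Ordinal (ltn_trans ltnu (ltn_ord u)).
have cond : (nats s arr_next 0 + 1 <= nats s arr_i 0 - 1)%N &&
            (nats s arr_done 0 <= 0)%N.
  by rewrite hi hn hd subn1 addn1 ltnu.
pose s1 := nset s arr_sol next 0.
pose s2 := rset s1 arr_val 2 (f ((u |: S) :\ j)).
have tr1 : tracks s1 ((u |: S) :\ j) by exact: (tracks_del j tr).
(* Common continuation when position [next] brings no swap, either because [j] is not in [S] or
   because the swap is not good. *)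
have next_step s3 : swap_ready s3 next -> same_env s s3 ->
    (j \in S -> ~~ good_swap j) ->
    exists s', [/\ reaches O (10 * d + 2)
        (NSet arr_next (NCst 0) (NAdd (scalar arr_next) (NCst 1))
           :: swap_loop l :: w, s3) (w, s'),
      same_env s s' & swap_result s' next].
  move=> [tr3 hi3 hn3 [hd3 h03 h13]] env3 bad.
  pose s4 := nset s3 arr_next 0 next.+1.
  have e4 : (next.+1 + d)%N = u by rewrite addSnnS.
  have r4 : swap_ready s4 next.+1 by split.
  have [s' [hr env res]] := IH s4 _ e4 r4; exists s'; split.
  - rewrite addnS; apply: reaches_step hr => /=.
    by rewrite hn3 addn1.
  - exact: same_env_trans env3 env.
  - case: res => [[hd' [tr' none]]|]; last by right.
    left; split=> //; split=> // i iS.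
    rewrite leq_eqVlt => /orP[/eqP ei|]; last exact: none.
    by have ij : i = j by [apply: val_inj]; rewrite ij in iS *; apply: bad.
have sj : nats s arr_sol next != 0%N = (j \in S).
  by rewrite (tracks_ord j tr) in_setU1 -val_eqE /= ltn_eqF.
have [jS|jS] := boolP (j \in S); last first.
  have rs : swap_ready s next by split.
  have es : same_env s s by [].
  have [s' [hr env res]] := next_step s rs es (fun h => False_ind _ (negP jS h)).
  exists s'; split=> //.
  apply: (@reaches_leq _ _ (10 * d + 2).+4); first by lia.
  apply: reaches_step; first by rewrite /= cond.
  apply: reaches_step => //.
  apply: reaches_step => //=.
  rewrite hn; have -> : (0 < nats s arr_sol next)%N = false.
    by rewrite lt0n sj (negPf jS).
  exact: reaches_step hr.
have val1 : O (fun x => nats s1 arr_sol x != 0%N) = f ((u |: S) :\ j).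
  apply: oracle_tracks => // i; rewrite in_setD1 => /andP[_]; exact: ltuS.
have test : beval s2 (swap_test l) = good_swap j.
  by rewrite /good_swap -h0 -h1.
pose s3 := if good_swap j then nset s2 arr_done 0 1 else nset s2 arr_sol next 1.
have hr3 : reaches O 9 (swap_loop l :: w, s)
    (NSet arr_next (NCst 0) (NAdd (scalar arr_next) (NCst 1)) :: swap_loop l :: w, s3).
  apply: reaches_step; first by rewrite /= cond.
  apply: reaches_step => //.
  apply: reaches_step => //=.
  rewrite hn; have -> : (0 < nats s arr_sol next)%N by rewrite lt0n sj jS.
  apply: reaches_step => //.
  apply: reaches_step; first by rewrite /= hn.
  apply: reaches_step => //.
  apply: reaches_step; first by rewrite /= val1 -/s2.
  apply: reaches_step; first by rewrite /machine_step test.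
  rewrite /s3; case: ifP => _; apply: reaches_step (reaches_refl _ _ _) => //=.
  by rewrite /upd /= hn.
have [good|bad] := boolP (good_swap j); last first.
  have e3 : s3 = nset s2 arr_sol next 1 by rewrite /s3 (negPf bad).
  have r3 : swap_ready s3 next.
    rewrite e3; split=> //; rewrite -(setD1K (_ : j \in u |: S)) ?setU1r //.
    exact: (tracks_add j 0 tr1).
  have es : same_env s s3 by rewrite e3.
  have [s' [hr env res]] := next_step s3 r3 es (fun _ => bad).
  exists s'; split=> //.
  by apply: reaches_leq (reaches_trans hr3 hr); lia.
(* After a successful swap the flag [arr_done] makes the next evaluation of the guard fail. *)
exists (nset s3 arr_next 0 next.+1); split.
- apply: (@reaches_leq _ _ (9 + 2)); first by lia.
  apply: reaches_trans hr3 _.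
  apply: reaches_step; first by rewrite /= /s3 good /= /upd /= hn addn1.
  apply: reaches_step (reaches_refl _ _ _).
  by rewrite /= /s3 good /= andbF.
- by rewrite /s3 good.
- by right; rewrite /s3 good; split=> //; exists j.
Qed.

End Correctness.

(** * Processing a sampled element is an exchange *)

Section Processing.
Variables (R : realType) (n k : nat) (f : {set 'I_n} -> R) (l : rat).
Let lam : R := ratr l.
Hypothesis f0 : nonnegative f.
Hypothesis f_sub : submodular f.
Hypothesis lam01 : 0 < lam < 1.

Definition holds (i : nat) (s : store R) (S : {set 'I_n}) : Prop :=
  [/\ tracks s S, {in S, forall j : 'I_n, (j < i)%N}, (#|S| <= k)%N,
      nats s arr_size 0 = #|S| & nats s arr_k 0 = k].

Lemma holdsW i s S : holds i s S -> holds i.+1 s S.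
Proof. by case=> tr lt *; split=> // j /lt /ltnW. Qed.

(** The longest path takes 7 steps to choose a branch, 5 to set up the loop, [10 * u + 1] in the
    loop and 2 to finish. *)
Lemma process_newest_spec (u : 'I_n) s S w :
  holds u s S -> nats s arr_i 0 = u.+1 ->
  exists s' S', [/\ reaches (value_oracle f u.+1) (10 * u + 15)
                      (process_newest l :: w, s) (w, s'),
                    holds u.+1 s' S' & exchange k f lam u S S'].
Proof.
move=> [tr lt leSk size_s k_s] i_s. pose O := value_oracle f u.+1.
have [l0 l1] := andP lam01.
have uS : u \notin S by apply/negP=> /lt; rewrite ltnn.
have ltu : {in u |: S, forall j : 'I_n, (j < u.+1)%N}.
  by move=> j; rewrite in_setU1 => /orP[/eqP->|/lt /ltnW].
have ltS : {in S, forall j : 'I_n, (j < u.+1)%N} by move=> j /lt /ltnW.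
have newest_s : (nats s arr_i 0 - 1)%N = u by rewrite i_s subn1.
pose s1 := nset (rset s arr_val 0 (f S)) arr_sol u 1.
pose s2 := rset s1 arr_val 1 (f (u |: S)).
have tr1 : tracks s1 (u |: S) by exact: (tracks_add u 0 (tr : tracks (rset s _ _ _) S)).
have val_S : O (fun j => nats s arr_sol j != 0%N) = f S by exact: oracle_tracks.
have val_uS : O (fun j => nats s1 arr_sol j != 0%N) = f (u |: S).
  exact: oracle_tracks.
pose branch := if (#|S| < k)%N then grow else swap l.
have to_branch : reaches O 7 (process_newest l :: w, s) (branch :: w, s2).
  apply: reaches_step => //.
  apply: reaches_step; first by rewrite /= val_S.
  apply: reaches_step => //.
  apply: reaches_step; first by rewrite /= newest_s.
  apply: reaches_step => //.
  apply: reaches_step; first by rewrite /= val_uS.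
  apply: reaches_step (reaches_refl _ _ _).
  by rewrite /= /upd /= size_s k_s addn1.
have drop_u (s' : store R) : tracks s' (u |: S) -> tracks (nset s' arr_sol u 0) S.
  by move=> h; rewrite -(setU1K uS); apply: tracks_del.
move: to_branch; rewrite /branch; case: ltnP => [ltSk|leSk'] to_branch.
  (* With room left, an accepted [u] gains its whole marginal, which is at least [lam] times itself;
     a rejected one has negative marginal, so the rejection bound follows from [0 <= f S]. *)
  have [up|down] := leP (f S) (f (u |: S)).
    exists (nset s2 arr_size 0 #|S|.+1), (u |: S); split.
    - apply: (@reaches_leq _ _ (7 + 2)); first by lia.
      apply: reaches_trans to_branch _.
      apply: reaches_step => //.
      apply: reaches_step (reaches_refl _ _ _).
      by rewrite /= /upd /= up /= /upd /= size_s addn1.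
    - by split; rewrite // cardsU1 uS.
    - by right; split=> //; rewrite ler_piMl ?subr_ge0 // ltW.
  exists (nset s2 arr_sol u 0), S; split.
  - apply: (@reaches_leq _ _ (7 + 2)); first by lia.
    apply: reaches_trans to_branch _.
    apply: reaches_step => //.
    apply: reaches_step (reaches_refl _ _ _).
    by rewrite /= /upd /= leNgt down /= /upd /= newest_s.
  - by split=> //; apply: drop_u.
  - left; split=> //; apply: le_trans (f0 S).
    by rewrite mulr_ge0_le0 // mulr_ge0_le0 ?subr_ge0 ?subr_le0 // ltW.
have cS : #|S| = k by apply/eqP; rewrite eqn_leq leSk.
pose s3 := nset (nset s2 arr_next 0 0) arr_done 0 0.
have ready : swap_ready f S u s3 0 by split.
pose finish := If (NLe (scalar arr_done) (NCst 0)) (NSet arr_sol newest (NCst 0)) Skip.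
have [s4 [to_s4 [k4 i4 size4] res]] :=
  swap_loop_spec (d := u) l lt (finish :: w) (add0n _) ready.
have to_finish : reaches O (7 + (5 + (10 * u + 1)))
    (process_newest l :: w, s) (finish :: w, s4).
  apply: reaches_trans to_branch _.
  apply: reaches_trans _ to_s4.
  by do 5!apply: reaches_step => //; apply: reaches_refl.
have size_s4 : nats s4 arr_size 0 = #|S| by rewrite size4.
have k_s4 : nats s4 arr_k 0 = k by rewrite k4.
have i_s4 : nats s4 arr_i 0 = u.+1 by rewrite i4.
case: res => [[done4 [tr4 noswap]]|[done4 [j jS [good tr4]]]].
  exists (nset s4 arr_sol u 0), S; split.
  - apply: (@reaches_leq _ _ (7 + (5 + (10 * u + 1)) + 2)); first by lia.
    apply: reaches_trans to_finish _.
    apply: reaches_step => //.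
    apply: reaches_step (reaches_refl _ _ _).
    by rewrite /= done4 /= i_s4 subn1.
  - by split=> //; apply: drop_u.
  - apply: no_swap_exchange => //; first by rewrite ltW.
    by move=> j jS; apply: noswap.
exists s4, ((u |: S) :\ j); split.
- apply: (@reaches_leq _ _ (7 + (5 + (10 * u + 1)) + 2)); first by lia.
  apply: reaches_trans to_finish _.
  apply: reaches_step => //.
  apply: reaches_step (reaches_refl _ _ _).
  by rewrite /= done4.
- have cj : #|(u |: S) :\ j| = #|S|.
    by have := cardsD1 j (u |: S); rewrite setU1r // cardsU1 uS => -[].
  split=> //; rewrite ?cj //.
  by move=> i; rewrite in_setD1 => /andP[_]; apply: ltu.
- right; split; first exact: subD1set.
    by case/andP: good.
  by case/andP: good => _; rewrite -/lam => ?; lra.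
Qed.

End Processing.

(** * The sampled program, its time bound and its competitive ratios *)

Section Competitiveness.
Variables (R : realType) (l r : rat).
Let lam : R := ratr l.
Let q : R := ratr r.

(* No coin is flipped at rate 1, which makes the monotone case deterministic. *)
Definition draw : cmd :=
  if r == 1 then NSet arr_coin (NCst 0) (NCst 1)
  else Coin arr_coin (NCst 0) (RCst r).

Definition program : cmd := sampled_swaps draw l.

Let T (i : nat) : nat := (20 * i ^ 1)%N.
Let alg : online_alg R := machine_alg R program T.

Definition halted_in (n k : nat) (i : nat) (c : config R) : Prop :=
  c.1 = [::] /\ exists S : {set 'I_n}, holds k i c.2 S.

Hypothesis lam01 : 0 < lam < 1.
Hypothesis q01 : 0 < q <= 1.

Section Instance.
Variables (n k : nat) (f : {set 'I_n} -> R).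
Hypothesis f0 : nonnegative f.
Hypothesis f_sub : submodular f.

Lemma alg_step (u : 'I_n) (c : config R) :
  halted_in n k u c ->
  exists m1 m0, [/\ halted_in n k u.+1 m1, halted_in n k u.+1 m0
                  & sampled_exchange (A := alg) k f lam q u c m1 m0].
Proof.
move=> [/= c1 [S hS]].
pose s0 := nset c.2 arr_i 0 u.+1.
pose coin b := nset s0 arr_coin 0 b.
have hcoin b : holds k u (coin b) S by case: hS.
have [s1 [S1 [to_s1 hS1 ex]]] :=
  process_newest_spec f0 f_sub lam01 [::] (hcoin 1%N) erefl.
have solE s S' : holds k u.+1 s S' -> sol_set (A := alg) n ([::], s) = S'.
  by case=> tr *; apply: tracks_sol_set.
have solS : sol_set (A := alg) n c = S.
  by case: (c) hS => ? ? [tr *]; apply: tracks_sol_set.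
(* At rate 1 the second memory is never reached and has weight [1 - q = 0]. *)
exists ([::], s1), ([::], coin 0%N); split.
- by split=> //; exists S1.
- by split=> //; exists S; apply: holdsW.
(* The two steps split off execute the outer [Seq] and the draw. *)
have T_u : T u.+1 = (20 * u + 18).+2 by rewrite /T expn1; lia.
pose rest := If (NLe (NCst 1) (scalar arr_coin)) (process_newest l) Skip.
have sampled : machine_steps (value_oracle f u.+1) (20 * u + 18)
    ([:: rest], coin 1%N) = Ret R ([::], s1).
  apply: reaches_halted.
  apply: (@reaches_leq _ _ (10 * u + 15).+1); first by lia.
  exact: reaches_step to_s1.
have skipped : machine_steps (value_oracle f u.+1) (20 * u + 18)
    ([:: rest], coin 0%N) = Ret R ([::], coin 0%N).
  apply: reaches_halted.
  apply: (@reaches_leq _ _ 2); first by lia.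
  by do 2!apply: reaches_step => //; apply: reaches_refl.
have stepE : step (o := alg) u.+1 (value_oracle f u.+1) c =
    if r == 1 then Ret R ([::], s1)
    else Flip q (Ret R ([::], s1)) (Ret R ([::], coin 0%N)).
  rewrite -[LHS]/(machine_steps _ (T u.+1) ([:: program], s0)) T_u.
  rewrite /program /sampled_swaps /draw /=.
  by case: ifP => _ /=; rewrite sampled // skipped.
split.
- by rewrite (solE _ _ hS1) solS.
- by rewrite solS; apply: solE; apply: holdsW.
- move=> g; rewrite stepE; case: ifP => [/eqP r1|_] /=.
    by rewrite /q r1 rmorph1 subrr mul0r addr0 mul1r.
  by rewrite clip_id //; case/andP: q01 => /ltW -> ->.
- move=> m'; rewrite stepE; case: ifP => _ /=; first by left.
  by case=> -[_ ->]; [left|right].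
Qed.

Lemma alg_init : halted_in n k 0 (init alg k).
Proof.
split=> //; exists set0; split; rewrite ?cards0 //.
  by move=> x; rewrite /= /upd /=; apply/esym/mapP=> -[j]; rewrite mem_enum inE.
by move=> j; rewrite inE.
Qed.

Lemma halted_in_sol i (m : Defs.mem alg) : halted_in n k i m ->
  (#|sol_set n m| <= k)%N /\ forall x, sol m x -> (x < i)%N.
Proof.
case: m => w s [_ [S [tr lt leS _ _]]]; rewrite (tracks_sol_set _ _ _ tr).
split=> // x; rewrite /= tr => /mapP[j]; rewrite mem_enum => /lt ltj -> //.
Qed.

Lemma alg_halts i (c : config R) :
  (i <= n)%N -> supp (run alg k f i) c -> c.1 = [::].
Proof.
move=> lein h.
by have [] := supp_run_inv (A := alg) (inv := halted_in n k) alg_init alg_step lein h.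
Qed.

Lemma alg_feasible : (k <= n)%N -> online_feasible alg k f.
Proof.
exact: sampled_exchange_feasible alg_init alg_step halted_in_sol.
Qed.

Lemma alg_value (L : R) (O : {set 'I_n}) :
  (#|O| <= k)%N -> (forall X : {set 'I_n}, O \subset X -> L <= f X) ->
  (1 - q) * f O + q * L <=
  ((lam * q)^-1 + (1 - lam)^-1) *
  expect (run alg k f n) (fun m => f (sol_set n m)).
Proof.
by apply: sampled_exchange_value alg_init alg_step halted_in_sol _ _ _ _ _ _.
Qed.

Lemma alg_ge_opt (alpha : R) : 0 < alpha ->
  (forall S : {set 'I_n}, (#|S| <= k)%N ->
    f S <= alpha^-1 * expect (run alg k f n) (fun m => f (sol_set n m))) ->
  alpha * opt k f <= expect (run alg k f n) (fun m => f (sol_set n m)).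
Proof.
move=> a0 h; rewrite -ler_pdivlMl //; apply/bigmax_leP; split; last exact: h.
(* The default value of the maximum is the value of the feasible set [set0]. *)
by apply: h; rewrite cards0.
Qed.

End Instance.

Lemma program_halts (cls : fun_class R) :
  (forall n f, cls n f -> nonnegative f /\ submodular f) ->
  halts_within cls program T.
Proof. by move=> sub n k f _ /sub[f0 f_sub] i c; apply: alg_halts. Qed.

End Competitiveness.

(* [56 / 627 < 9 / 100]; the sampling rate [9 / 25] and the threshold [5 / 8]
   are near the maximum of [(1 - q) / (1 / (lam * q) + 1 / (1 - lam))]. *)
Lemma nonmonotone_ratio (R : realType) (alpha : R) : alpha <= 9%:R / 100%:R ->
  poly_time_competitive (@nonneg_submodular R) alpha
    (program (5%:R / 8%:R) (9%:R / 25%:R)).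
Proof.
have lamE : ratr (5%:R / 8%:R) = 5%:R / 8%:R :> R by rewrite fmorph_div !rmorph_nat.
have qE : ratr (9%:R / 25%:R) = 9%:R / 25%:R :> R by rewrite fmorph_div !rmorph_nat.
have lam01 : 0 < (ratr (5%:R / 8%:R) : R) < 1 by rewrite lamE; lra.
have q01 : 0 < (ratr (9%:R / 25%:R) : R) <= 1 by rewrite qE; lra.
move=> le_alpha; exists 20%N, 1%N; split.
  by apply: program_halts => // n f [].
move=> n k f lekn [f0 f_sub]; split; first exact: alg_feasible.
have opt0 : 0 <= opt k f by apply: le_trans (f0 set0) _; apply: bigmax_ge_id.
apply: le_trans (ler_wpM2r opt0 le_alpha) _.
apply: alg_ge_opt => [|S leS]; first by lra.
(* With [L = 0] this reads [16/25 * f S <= 64/9 * E], where [E] is the expected value, that is,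
   [f S <= 100/9 * E]. *)
have := alg_value lam01 q01 f0 f_sub leS (fun X _ => f0 X).
rewrite lamE qE invf_div.
have -> : (5%:R / 8%:R * (9%:R / 25%:R))^-1 + (1 - 5%:R / 8%:R)^-1 = 64%:R / 9%:R :> R.
  by field.
by lra.
Qed.

(** With [q = 1] and [L = f O] the loss is [1 / lam + 1 / (1 - lam) = 1 / (lam * (1 - lam))], which
    is least at [lam = 1/2], where it equals 4. *)
Lemma monotone_ratio (R : realType) :
  poly_time_competitive (@nonneg_submodular_monotone R) (1 / 4%:R)
    (program (1 / 2%:R) 1).
Proof.
have lamE : ratr (1 / 2%:R) = 1 / 2%:R :> R by rewrite fmorph_div rmorph1 rmorph_nat.
have qE : ratr 1 = 1 :> R by rewrite rmorph1.
have lam01 : 0 < (ratr (1 / 2%:R) : R) < 1 by rewrite lamE; lra.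
have q01 : 0 < (ratr 1 : R) <= 1 by rewrite qE; lra.
exists 20%N, 1%N; split.
  by apply: program_halts => // n f [].
move=> n k f lekn [f0 f_sub f_mono]; split; first exact: alg_feasible.
apply: alg_ge_opt => [|S leS]; first by lra.
have := alg_value lam01 q01 f0 f_sub leS (fun X sSX => f_mono _ _ sSX).
rewrite lamE qE invf_div.
have -> : (1 / 2%:R * 1)^-1 + (1 - 1 / 2%:R)^-1 = 4%:R :> R by field.
by lra.
Qed.

Theorem theorem1p5 (R : realType) :
  [/\ exists A : online_alg R,
        competitive (@nonneg_submodular R) (56%:R / 627%:R) A,
      forall eps : R, 0 < eps ->
        exists P : cmd,
          poly_time_competitive (@nonneg_submodular R)
            (56%:R / 627%:R - eps) P
    & exists P : cmd,
        coin_free P /\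
        poly_time_competitive (@nonneg_submodular_monotone R) (1 / 4%:R) P].
Proof.
split.
(* One polynomial time program serves the first two claims, since its ratio [9/100] already exceeds
   [56/627]. *)
- have [|C [d [_ comp]]] := @nonmonotone_ratio R (56%:R / 627%:R); first by lra.
  by exists (machine_alg R (program (5%:R / 8%:R) (9%:R / 25%:R))
               (fun i => (C * i ^ d)%N)).
- move=> eps eps0; exists (program (5%:R / 8%:R) (9%:R / 25%:R)).
  by apply: nonmonotone_ratio; lra.
- exists (program (1 / 2%:R) 1); split; last exact: monotone_ratio.
  by rewrite /program /draw eqxx.
Qed.
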